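(* Let $\Gamma=A\times B$ be a direct product of two finitely generated groups $A$ and $B$. Suppose that $\alpha:\Gamma\to\Gamma$ is an endomorphism such that either $\alpha(A)\subset A$ or $\alpha(B)\subset B$. Then $$GR(\alpha\text{ on }\Gamma)=\max\{GR(\alpha\text{ on }A),\ GR(\alpha\text{ on }B)\}.$$
   Context: For a group $G$ with finite generating set $T$ and $g\in G$, $|g|_T$ denotes the length of the shortest word in the letters $T\cup T^{-1}$ representing $g$. The growth rate of an endomorphism $\beta:G\to G$ is $GR(\beta)=\sup_{g\in G}\ \limsup_{m\to\infty}\sqrt[m]{|\beta^m(g)|_T}$. $GR(\alpha\text{ on }\Gamma)=GR(\alpha)$. If a factor is mapped into itself by $\alpha$, the growth rate of $\alpha$ on it is that of the restriction of $\alpha$. If only one factor is mapped into itself, say $\alpha(A)\subset A$, then $GR(\alpha\text{ on }B)$ denotes the growth rate of the endomorphism of $\Gamma/A\cong B$ induced by $\alpha$ (and symmetrically with $A$ and $B$ exchanged). *)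

(* Defs.v *)
From HB Require Import structures.
From mathcomp Require Import all_boot all_order all_algebra.
From mathcomp Require Import all_classical all_reals all_analysis.

Set Implicit Arguments.
Unset Strict Implicit.
Unset Printing Implicit Defensive.

Local Open Scope classical_set_scope.

Section WordLength.
Variables (G : groupType) (T : seq G).

Definition word_on (w : seq G) : Prop :=
  forall x, x \in w -> x \in T \/ (x^-1)%g \in T.

Definition spelled_in (n : nat) (g : G) : Prop :=
  exists w : seq G, [/\ word_on w, size w = n & (\prod_(x <- w) x)%g = g].

Definition generates : Prop := forall g : G, exists n, spelled_in n g.

(* The default value 0 is only used when g is not in the subgroup generated
   by T. *)
Definition word_length (g : G) : nat :=
  xget 0 [set n | spelled_in n g /\ forall k, spelled_in k g -> n <= k].

End WordLength.

(* The supremum and the limit superior are taken in the extended reals. The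
   term of index m = 0, where (0 : R)^-1 = 0, does not affect the limit
   superior. *)
Definition growth_rate (R : realType) (G : groupType) (T : seq G)
    (beta : {multiplicative G -> G}) : \bar R :=
  ereal_sup [set limn_esup (fun m : nat =>
      (((word_length T (iter m beta g))%:R : R) `^ (m%:R^-1))%:E) | g in setT].

Section DirectProduct.
Variables A B : groupType.

Definition left_factor : set (A * B) := [set g | g.2 = 1%g].
Definition right_factor : set (A * B) := [set g | g.1 = 1%g].

Variable alpha : {multiplicative (A * B)%type -> (A * B)%type}.

Definition stabilizes (H : set (A * B)) : Prop := alpha @` H `<=` H.

(* The endomorphism of A meant by "alpha on A": it is the restriction of alpha
   when alpha maps A into itself (left_endo_restr), and the endomorphism
   induced on (A * B) / B, identified with A by the first projection, when
   alpha maps B into itself (left_endo_quot). The two agree when both apply.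
   Likewise for right_endo. *)
Definition left_endo (a : A) : A := (alpha (a, 1%g)).1.
Definition right_endo (b : B) : B := (alpha (1%g, b)).2.

Fact left_endoM : {morph left_endo : x y / (x * y)%g}.
Proof.
move=> x y; rewrite /left_endo.
have -> : (x * y, 1)%g = ((x, 1) * (y, 1))%g :> A * B.
  by congr pair; rewrite mulg1.
by rewrite gmulfM.
Qed.

Fact right_endoM : {morph right_endo : x y / (x * y)%g}.
Proof.
move=> x y; rewrite /right_endo.
have -> : (1, x * y)%g = ((1, x) * (1, y))%g :> A * B.
  by congr pair; rewrite mulg1.
by rewrite gmulfM.
Qed.

HB.instance Definition _ := isMultiplicative.Build A A left_endo left_endoM.
HB.instance Definition _ := isMultiplicative.Build B B right_endo right_endoM.

Lemma left_endo_restr : stabilizes left_factor ->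
  forall a, alpha (a, 1%g) = (left_endo a, 1%g).
Proof.
move=> stab a.
have a1 : (alpha (a, 1%g)).2 = 1%g by apply: stab; exists (a, 1%g).
by rewrite [LHS]surjective_pairing a1.
Qed.

Lemma right_endo_restr : stabilizes right_factor ->
  forall b, alpha (1%g, b) = (1%g, right_endo b).
Proof.
move=> stab b.
have b1 : (alpha (1%g, b)).1 = 1%g by apply: stab; exists (1%g, b).
by rewrite [LHS]surjective_pairing b1.
Qed.

Lemma left_endo_quot : stabilizes right_factor ->
  forall g, (alpha g).1 = left_endo g.1.
Proof.
move=> stab [a b] /=.
have -> : (a, b) = ((a, 1) * (1, b))%g :> A * B.
  by congr pair; rewrite ?mulg1 ?mul1g.
by rewrite gmulfM right_endo_restr//= mulg1.
Qed.

Lemma right_endo_quot : stabilizes left_factor ->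
  forall g, (alpha g).2 = right_endo g.2.
Proof.
move=> stab [a b] /=.
have -> : (a, b) = ((a, 1) * (1, b))%g :> A * B.
  by congr pair; rewrite ?mulg1 ?mul1g.
by rewrite gmulfM left_endo_restr//= mul1g.
Qed.

End DirectProduct.

Arguments left_factor {A B}.
Arguments right_factor {A B}.

(* Main.v *)
From HB Require Import structures.
Require Import Defs.
From mathcomp Require Import all_boot all_order all_algebra.
From mathcomp Require Import all_classical all_reals all_analysis.
From mathcomp Require Import ring lra.

(** Say that alpha maps A into itself; the other case is the same with the two
factors exchanged. Then Gamma is a split extension of Q = B by N = A, and alpha
induces endomorphisms phi of N and chi of Q.

The growth rate of alpha is at least that of phi and that of chi because
homomorphisms between finitely generated groups are Lipschitz for word
lengths: a retraction Gamma -> N carries the alpha-orbit of an element of N to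
its phi-orbit, and the projection Gamma -> Q carries alpha-orbits to chi-orbits
([growth_rate_sub], [growth_rate_quot]).

For the upper bound, let psi q be the N-component of alpha q, for q in Q, so
that alpha q = psi q * chi q. Iterating,

  alpha^m q = phi^(m-1) (psi q) * phi^(m-2) (psi (chi q)) * ... *
              psi (chi^(m-1) q) * chi^m q.

Suppose that l exceeds both growth rates. Because N is finitely generated,
|phi^j x| <= C |x| l^j with C independent of x ([uniform_exp_bounded]), and
likewise for chi. Hence each of the m factors phi^j (psi (chi^k q)), with
j + k = m - 1, has length at most a constant times l^(m-1), and
|alpha^m q| <= (c1 m + c2) l^m. The factor m disappears on taking m-th roots;
here it is absorbed by replacing l by a slightly larger r ([affine_expr_le]).

Growth rates enter only through [exp_bounded]: up to an arbitrarily small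
change of l, the inequality limsup |beta^m g|^(1/m) <= l means that
|beta^m g| <= C l^m for some C and all m. *)

Set Implicit Arguments.
Unset Strict Implicit.
Unset Printing Implicit Defensive.

Import Order.TTheory GRing.Theory Num.Theory.
Local Open Scope ring_scope.

(** * Exponential bounds and limits of roots *)

Lemma bernoulli_le (R : realFieldType) (h : R) (m : nat) :
  0 <= h -> 1 + m%:R * h <= (1 + h) ^+ m.
Proof.
move=> h0; elim: m => [|m IH]; first by rewrite mul0r addr0 expr0.
have P : 0 <= m%:R * h * h by rewrite !mulr_ge0.
rewrite exprSr; apply: (@le_trans _ _ ((1 + m%:R * h) * (1 + h))).
  by rewrite -natr1; lra.
by apply: ler_wpM2r => //; lra.
Qed.

(** By Bernoulli's inequality (r / l)^m grows at least linearly in m. *)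
Lemma affine_expr_le (R : realFieldType) (c d l r : R) :
  0 <= c -> 0 <= d -> 0 < l -> l < r ->
  exists C, forall m, (m%:R * c + d) * l ^+ m <= C * r ^+ m.
Proof.
move=> c0 d0 l0 lr.
pose h := r / l - 1.
have h0 : 0 < h by rewrite /h subr_gt0 ltr_pdivlMr// mul1r.
have rE : r = (1 + h) * l by rewrite /h addrC subrK divfK// gt_eqF.
exists (c / h + d) => m.
rewrite rE exprMn mulrA ler_wpM2r ?exprn_ge0 ?(ltW l0)//.
have cd0 : 0 <= c / h + d by rewrite addr_ge0// divr_ge0// ltW.
apply: le_trans (ler_wpM2l cd0 (bernoulli_le m (ltW h0))).
have -> : (c / h + d) * (1 + m%:R * h) = m%:R * c + d + (c / h + d * (m%:R * h)).
  by field; rewrite gt_eqF.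
by rewrite lerDl addr_ge0 ?divr_ge0 ?mulr_ge0// ltW.
Qed.

Definition exp_bounded (R : realType) (l : R) (u : nat -> nat) : Prop :=
  exists C : R, forall m, (u m)%:R <= C * l ^+ m.

Lemma exp_bounded_le (R : realType) (l r : R) (u : nat -> nat) :
  0 <= l -> l <= r -> exp_bounded l u -> exp_bounded r u.
Proof.
move=> l0 lr [C uC]; exists C => m; apply: le_trans (uC m) _.
apply: ler_wpM2l; last by rewrite lerXn2r ?nnegrE ?(le_trans l0).
by have := uC 0%N; rewrite expr0 mulr1; apply: le_trans.
Qed.

Definition root_limsup (R : realType) (u : nat -> nat) : \bar R :=
  limn_esup (fun m : nat => (((u m)%:R : R) `^ (m%:R^-1))%:E).

Lemma exprn_root (R : realType) (x : R) (m : nat) :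
  0 <= x -> (0 < m)%N -> (x `^ m%:R^-1) ^+ m = x.
Proof.
move=> x0 m0; rewrite -powR_mulrn ?powR_ge0// -powRrM mulVf ?powRr1//.
by rewrite pnatr_eq0 -lt0n.
Qed.

(** By definition of the limit superior, u m <= l^m from some N on; the finitely
many earlier terms only affect the constant. *)
Lemma exp_bounded_root_limsup_lt (R : realType) (l : R) (u : nat -> nat) :
  0 < l -> (root_limsup R u < l%:E)%E -> exp_bounded l u.
Proof.
move=> l0 /ereal_inf_lt[_ [V [N _ NV] <-] supV].
have big m : (N <= m)%N -> (0 < m)%N -> (u m)%:R <= l ^+ m :> R.
  move=> Nm m0; rewrite -(@exprn_root R (u m)%:R m)//.
  rewrite lerXn2r ?nnegrE ?powR_ge0 ?(ltW l0)//.
  rewrite -lee_fin; apply: le_trans (ltW supV).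
  by apply: ereal_sup_ubound; exists m => //; apply: NV.
(* N + 1 terms are summed so that the index 0, where the m-th root is
   meaningless, is always among the exceptional ones. *)
exists (1 + \sum_(i < N.+1) (u i)%:R / l ^+ i) => m.
have t0 i : 0 <= (u i)%:R / l ^+ i :> R by rewrite divr_ge0// exprn_ge0// ltW.
rewrite -ler_pdivrMr ?exprn_gt0//.
have [mN|Nm] := ltnP m N.+1.
  rewrite (bigD1 (Ordinal mN))//= addrCA lerDl addr_ge0//.
  by apply: sumr_ge0.
apply: (@le_trans _ _ 1).
  rewrite ler_pdivrMr ?exprn_gt0// mul1r big//; first exact: ltnW.
  exact: leq_trans Nm.
by rewrite lerDl sumr_ge0.
Qed.

(** For r > l, C (l / r)^m tends to 0, so that C l^m <= r^m from some point on:
the constant does not survive the m-th root. *)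
Lemma root_limsup_le (R : realType) (l : R) (u : nat -> nat) :
  0 < l -> exp_bounded l u -> (root_limsup R u <= l%:E)%E.
Proof.
move=> l0 [C uC]; apply/lee_addgt0Pr => e e0; rewrite -EFinD.
set r := l + e; have r0 : 0 < r by rewrite addr_gt0.
have z1 : `|l / r| < 1.
  by rewrite ger0_norm ?divr_ge0 ?(ltW l0) ?(ltW r0)// ltr_pdivrMr// mul1r
    /r ltrDl.
have [N _ NC] : \forall m \near \oo%classic, C * (l / r) ^+ m <= 1.
  exact: (cvgr_le _ (cvg_geometric C z1) _ ltr01).
apply: le_trans (_ : ereal_sup _ <= _)%E.
  apply: ereal_inf_lbound; exists [set m | (N.+1 <= m)%N]%classic.
    by exists N.+1.
  by [].
apply: ge_ereal_sup => _ [m Nm <-]; rewrite lee_fin.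
have m0 : (0 < m)%N by exact: leq_trans Nm.
rewrite -(@ler_pXn2r _ m)// ?nnegrE ?powR_ge0 ?(ltW r0)//.
rewrite exprn_root//; apply: le_trans (uC m) _.
have /= := NC m (ltnW Nm).
by rewrite expr_div_n mulrA ler_pdivrMr ?exprn_gt0// mul1r.
Qed.

(** * Word lengths *)

Section WordLength.
Variables (G : groupType) (T : seq G).

Lemma word_length_spec (g : G) : generates T ->
  spelled_in T (word_length T g) g /\
  forall k, spelled_in T k g -> (word_length T g <= k)%N.
Proof.
move=> /(_ g) [n ng]; apply: (@xgetPex _ 0%N
  [set n | spelled_in T n g /\ forall k, spelled_in T k g -> (n <= k)%N]%classic).
have [P|] := pselect (exists n, `[< spelled_in T n g >]); last first.
  by case; exists n; apply/asboolP.
exists (ex_minn P); case: ex_minnP => k /asboolP kg kmin; split=> // j jg.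
by apply: kmin; apply/asboolP.
Qed.

(** A subadditive quantity is bounded by a multiple of the word length, as it is
bounded on the finitely many letters. Subadditivity is stated for a relation
Q c g, read as: g has size at most c. A single instance can then speak of the
size of f g, or of the sizes of a whole orbit of g at once. *)
Lemma subadditive_le_word_length (R : realType) (Q : R -> G -> Prop) : generates T ->
  (forall x y g, x <= y -> Q x g -> Q y g) ->
  Q 0 1%g ->
  (forall x y g h, Q x g -> Q y h -> Q (x + y) (g * h)%g) ->
  (forall g, exists C, Q C g) ->
  exists2 K, 0 <= K & forall g, Q (K * (word_length T g)%:R) g.
Proof.
move=> hT Qmono Q1 QM Qex.
have [K K0 KT] : exists2 K, 0 <= K & forall x, x \in T -> Q K x /\ Q K x^-1%g.
  elim: (T) => [|t s [K K0 IH]]; first by exists 0.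
  have [[C Ct] [D Dt]] := (Qex t, Qex t^-1%g).
  exists (K + `|C| + `|D|); first by rewrite !addr_ge0.
  have ? := ler_norm C; have ? := ler_norm D.
  have ? := normr_ge0 C; have ? := normr_ge0 D.
  move=> x; rewrite inE => /predU1P[->|/IH[Kx Kx']]; split.
  - by apply: Qmono Ct; lra.
  - by apply: Qmono Dt; lra.
  - by apply: Qmono Kx; lra.
  - by apply: Qmono Kx'; lra.
exists K => // g; have [[w [wT <- <-]] _] := word_length_spec g hT.
elim: w wT => [|x w IH] wT; first by rewrite big_nil mulr0.
rewrite big_cons /= -natr1 mulrDr mulr1 addrC; apply: QM.
  have [/KT[]//|/KT[_]] := wT x (mem_head _ _); by rewrite invgK.
by apply: IH => y yw; apply: wT; rewrite inE yw orbT.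
Qed.

Lemma word_length1 : generates T -> word_length T 1%g = 0%N.
Proof.
move=> hT; apply/eqP; rewrite -leqn0; apply: (word_length_spec _ hT).2.
by exists [::]; split=> //; rewrite big_nil.
Qed.

Lemma word_lengthM (g h : G) : generates T ->
  (word_length T (g * h)%g <= word_length T g + word_length T h)%N.
Proof.
move=> hT; apply: (word_length_spec _ hT).2.
have [[v [vT sv pv]] _] := word_length_spec g hT.
have [[w [wT sw pw]] _] := word_length_spec h hT.
exists (v ++ w); split; rewrite ?size_cat ?big_cat ?sv ?sw ?pv ?pw//.
by move=> x; rewrite mem_cat => /orP[/vT|/wT].
Qed.

End WordLength.

Lemma morph1 (G H : groupType) (f : G -> H) :
  {morph f : x y / (x * y)%g} -> f 1%g = 1%g.
Proof. by move=> fM; apply: (@mulgI _ (f 1%g)); rewrite -fM !mulg1. Qed.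

Lemma iter_morph (G : groupType) (f : G -> G) m :
  {morph f : x y / (x * y)%g} -> {morph iter m f : x y / (x * y)%g}.
Proof. by move=> fM x y; elim: m => //= m ->; rewrite fM. Qed.

(** Homomorphisms are Lipschitz for word lengths: the images of the finitely many
letters have bounded length. *)
Lemma word_length_lipschitz (R : realType) (G H : groupType)
    (TG : seq G) (TH : seq H) (f : G -> H) : generates TG -> generates TH ->
  {morph f : x y / (x * y)%g} ->
  exists2 K : R, 0 <= K &
    forall g, (word_length TH (f g))%:R <= K * (word_length TG g)%:R.
Proof.
move=> hG hH fM.
apply: (@subadditive_le_word_length _ _ R (fun c g => (word_length TH (f g))%:R <= c)) => //.
- by move=> x y g xy /le_trans; apply.
- by rewrite (morph1 fM) word_length1.
- move=> x y g h gx hy; rewrite fM.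
  by apply: le_trans (lerD gx hy); rewrite -natrD ler_nat word_lengthM.
- by move=> g; exists (word_length TH (f g))%:R.
Qed.

(** * Growth rates *)

Definition growth_at (G : groupType) (T : seq G) (beta : G -> G) (g : G)
    (m : nat) : nat :=
  word_length T (iter m beta g).

(** The least C with |beta^m g| <= C l^m for all m is subadditive in g, hence at
most linear in |g|. This makes the bound usable along an orbit, where g itself
varies. *)
Lemma uniform_exp_bounded (R : realType) (l : R) (G : groupType) (T : seq G)
    (beta : G -> G) : 0 < l -> generates T -> {morph beta : x y / (x * y)%g} ->
  (forall g, exp_bounded l (growth_at T beta g)) ->
  exists2 K : R, 0 <= K & forall g m,
    (word_length T (iter m beta g))%:R <= K * (word_length T g)%:R * l ^+ m.
Proof.
move=> l0 hT bM bdd.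
have lm m : 0 <= l ^+ m by rewrite exprn_ge0// ltW.
apply: (@subadditive_le_word_length _ _ R
  (fun c g => forall m, (word_length T (iter m beta g))%:R <= c * l ^+ m)) => //.
- by move=> x y g xy gx m; apply: le_trans (gx m) _; rewrite ler_wpM2r.
- by move=> m; rewrite (morph1 (iter_morph m bM)) word_length1// mul0r.
- move=> x y g h gx hy m; rewrite (iter_morph m bM) mulrDl.
  by apply: le_trans (lerD (gx m) (hy m)); rewrite -natrD ler_nat word_lengthM.
Qed.

Lemma growth_rate_ge0 (R : realType) (G : groupType) (T : seq G)
  (beta : {multiplicative G -> G}) : (0 <= growth_rate R T beta)%E.
Proof.
apply: le_trans (_ : root_limsup R (growth_at T beta 1%g) <= _)%E; last first.
  by apply: ereal_sup_ubound; exists 1%g.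
apply: le_ereal_inf_tmp => _ [V [N _ NV] <-].
apply: (@le_trans _ _ ((growth_at T beta 1%g N)%:R `^ N%:R^-1)%:E).
  by rewrite lee_fin powR_ge0.
by apply: ereal_sup_ubound; exists N => //; apply: NV => /=.
Qed.

Lemma exp_bounded_growth_rate_lt (R : realType) (l : R) (G : groupType)
    (T : seq G) (beta : {multiplicative G -> G}) (g : G) :
  0 < l -> (growth_rate R T beta < l%:E)%E -> exp_bounded l (growth_at T beta g).
Proof.
move=> l0 bl; apply: exp_bounded_root_limsup_lt => //.
by apply: le_lt_trans bl; apply: ereal_sup_ubound; exists g.
Qed.

Lemma growth_rate_le (R : realType) (l : R) (G : groupType)
    (T : seq G) (beta : {multiplicative G -> G}) :
  0 < l -> (forall g, exp_bounded l (growth_at T beta g)) ->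
  (growth_rate R T beta <= l%:E)%E.
Proof.
move=> l0 bl; apply: ge_ereal_sup => _ [g _ <-].
exact: (root_limsup_le l0 (bl g)).
Qed.

(** The form in which upper bounds for growth rates are proved: given l > x, a
bound with a larger ratio r is enough, which leaves room to absorb polynomial
factors. *)
Lemma growth_rate_le_of_bounds (R : realType) (G : groupType)
    (T : seq G) (beta : {multiplicative G -> G}) (x : \bar R) : (0 <= x)%E ->
  (forall l r : R, 0 < l -> l < r -> (x < l%:E)%E ->
     forall g, exp_bounded r (growth_at T beta g)) ->
  (growth_rate R T beta <= x)%E.
Proof.
case: x => [x| |]// x0 H; last by rewrite leey.
rewrite lee_fin in x0.
apply/lee_addgt0Pr => e e0; rewrite -EFinD.
apply: growth_rate_le => [|g]; first by lra.
by apply: (H (x + e / 2)); rewrite ?lte_fin; lra.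
Qed.

(** * Split extensions *)

(** The product enters only through the split exact sequence N -> G -> Q with
inclusion i, retraction r, section s and projection p; this covers both
invariant factors of a direct product at once. *)

Section SplitExtension.
Variables (R : realType) (N G Q : groupType).
Variables (TN : seq N) (TG : seq G) (TQ : seq Q).
Hypotheses (hN : generates TN) (hG : generates TG) (hQ : generates TQ).
Variables (i : {multiplicative N -> G}) (r : {multiplicative G -> N}).
Variables (s : {multiplicative Q -> G}) (p : {multiplicative G -> Q}).
Hypotheses (iK : cancel i r) (sK : cancel s p).
Hypothesis irsp : forall g, g = (i (r g) * s (p g))%g.
Variables (alpha : {multiplicative G -> G}) (phi : {multiplicative N -> N}).
Variable chi : {multiplicative Q -> Q}.
Hypothesis alpha_i : forall n, alpha (i n) = i (phi n).
Hypothesis p_alpha : forall g, p (alpha g) = chi (p g).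

Let iter_i m n : iter m alpha (i n) = i (iter m phi n).
Proof. by elim: m => //= m ->. Qed.

Let p_iter m g : p (iter m alpha g) = iter m chi (p g).
Proof. by elim: m => //= m <-. Qed.

Lemma growth_rate_sub : (growth_rate R TN phi <= growth_rate R TG alpha)%E.
Proof.
have [K K0 rK] := word_length_lipschitz R hG hN (gmulfM (s := r)).
apply: growth_rate_le_of_bounds => [|l l' l0 ll' al n].
  exact: growth_rate_ge0.
have [C aC] := exp_bounded_growth_rate_lt (i n) l0 al.
apply: (exp_bounded_le (ltW l0) (ltW ll')).
exists (K * C) => m; rewrite /growth_at -(iK (iter m phi n)) -iter_i.
by apply: le_trans (rK _) _; rewrite -mulrA ler_wpM2l//; exact: aC.
Qed.

Lemma growth_rate_quot : (growth_rate R TQ chi <= growth_rate R TG alpha)%E.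
Proof.
have [K K0 pK] := word_length_lipschitz R hG hQ (gmulfM (s := p)).
apply: growth_rate_le_of_bounds => [|l l' l0 ll' al q].
  exact: growth_rate_ge0.
have [C aC] := exp_bounded_growth_rate_lt (s q) l0 al.
apply: (exp_bounded_le (ltW l0) (ltW ll')).
exists (K * C) => m; rewrite /growth_at -{1}(sK q) -p_iter.
by apply: le_trans (pK _) _; rewrite -mulrA ler_wpM2l//; exact: aC.
Qed.

(** The iteration of alpha (s q) = i (psi q) * s (chi q) gives a sum of m terms,
each of size at most a constant times l^m. *)
Lemma growth_rate_ext : (growth_rate R TG alpha <=
  maxe (growth_rate R TN phi) (growth_rate R TQ chi))%E.
Proof.
apply: growth_rate_le_of_bounds => [|l l' l0 ll'].
  by rewrite le_max growth_rate_ge0.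
rewrite gt_max => /andP[Nl Ql] g.
pose psi q := r (alpha (s q)).
have psiM : {morph psi : x y / (x * y)%g} by move=> x y; rewrite /psi !gmulfM.
have alpha_s q : alpha (s q) = (i (psi q) * s (chi q))%g.
  by rewrite [LHS]irsp p_alpha sK.
have [Ki Ki0 iB] := word_length_lipschitz R hN hG (gmulfM (s := i)).
have [Ks Ks0 sB] := word_length_lipschitz R hQ hG (gmulfM (s := s)).
have [Kp Kp0 psiB] := word_length_lipschitz R hQ hN psiM.
have [Cn Cn0 phiB] := uniform_exp_bounded l0 hN (gmulfM (s := phi))
  (fun n => exp_bounded_growth_rate_lt n l0 Nl).
have [Cq Cq0 chiB] := uniform_exp_bounded l0 hQ (gmulfM (s := chi))
  (fun q => exp_bounded_growth_rate_lt q l0 Ql).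
set n := r g.
set q := p g.
pose L := (word_length TQ q)%:R : R.
(* The division by l reflects that each factor has size of order l^(m-1). *)
pose c1 := Ki * (Cn * (Kp * (Cq * L))) / l.
pose c2 := Ks * (Cq * L).
have L0 : 0 <= L by [].
have c10 : 0 <= c1 by rewrite divr_ge0 ?mulr_ge0// ltW.
have c20 : 0 <= c2 by rewrite !mulr_ge0.
have iter_n x m : (word_length TG (iter m alpha (i x)))%:R
    <= Ki * (Cn * (word_length TN x)%:R) * l ^+ m.
  by rewrite iter_i; apply: le_trans (iB _) _; rewrite -mulrA ler_wpM2l.
have iter_s m k : (word_length TG (iter m alpha (s (iter k chi q))))%:R
    <= (m%:R * c1 + c2) * l ^+ (m + k).
  (* The induction moves one step of chi from the remaining iterates of alpha to
     the index k, and keeps m + k fixed. *)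
  elim: m k => [|m IH] k.
    rewrite mul0r add0r add0n /= /c2 -mulrA.
    by apply: le_trans (sB _) _; rewrite ler_wpM2l.
  rewrite iterSr alpha_s (iter_morph m (gmulfM (s := alpha))).
  apply: (@le_trans _ _ (Ki * (Cn * (Kp * (Cq * L * l ^+ k))) * l ^+ m
    + (m%:R * c1 + c2) * l ^+ (m + k.+1))).
    have iB' : (word_length TG (iter m alpha (i (psi (iter k chi q)))))%:R
        <= Ki * (Cn * (Kp * (Cq * L * l ^+ k))) * l ^+ m.
      apply: le_trans (iter_n _ _) _.
      rewrite ler_wpM2r ?exprn_ge0 ?(ltW l0)// !ler_wpM2l//.
      by apply: le_trans (psiB _) _; rewrite ler_wpM2l// chiB.
    apply: le_trans (lerD iB' (IH k.+1)).
    by rewrite -natrD ler_nat word_lengthM.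
  rewrite addnS -natr1 addSn !exprS !exprD /c1.
  by rewrite le_eqVlt; apply/orP; left; apply/eqP; field; rewrite gt_eqF.
have c30 : 0 <= Ki * (Cn * (word_length TN n)%:R) + c2.
  by rewrite addr_ge0 ?mulr_ge0.
have [C CP] := affine_expr_le c10 c30 l0 ll'.
exists C => m; apply: le_trans (CP m).
rewrite /growth_at {1}[g]irsp (iter_morph m (gmulfM (s := alpha))).
apply: (@le_trans _ _ ((word_length TG (iter m alpha (i n)))%:R
  + (word_length TG (iter m alpha (s q)))%:R)).
  by rewrite -natrD ler_nat word_lengthM.
apply: le_trans (lerD (iter_n n m) (iter_s m 0%N)) _.
by rewrite addn0 -mulrDl addrCA.
Qed.

Theorem growth_rate_split_extension : growth_rate R TG alpha =
  maxe (growth_rate R TN phi) (growth_rate R TQ chi).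
Proof.
apply/eqP; rewrite eq_le growth_rate_ext ge_max.
by rewrite growth_rate_sub growth_rate_quot.
Qed.

End SplitExtension.

(** * Direct products *)

Section Injections.
Variables A B : groupType.

Definition inl_prod (a : A) : A * B := (a, 1%g).
Definition inr_prod (b : B) : A * B := (1%g, b).

Fact inl_prodM : {morph inl_prod : x y / (x * y)%g}.
Proof. by move=> x y; congr pair; rewrite mulg1. Qed.

Fact inr_prodM : {morph inr_prod : x y / (x * y)%g}.
Proof. by move=> x y; congr pair; rewrite mulg1. Qed.

HB.instance Definition _ := isMultiplicative.Build A (A * B)%type
  inl_prod inl_prodM.
HB.instance Definition _ := isMultiplicative.Build B (A * B)%type
  inr_prod inr_prodM.

End Injections.

Theorem lemma5p1 (R : realType) (A B : groupType)
    (TA : seq A) (TB : seq B) (T : seq (A * B))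
    (hTA : generates TA) (hTB : generates TB) (hT : generates T)
    (alpha : {multiplicative (A * B)%type -> (A * B)%type})
    (hstab : stabilizes alpha left_factor \/ stabilizes alpha right_factor) :
  growth_rate R T alpha =
    maxe (growth_rate R TA (left_endo alpha))
         (growth_rate R TB (right_endo alpha)).
Proof.
case: hstab => stab.
  apply: (@growth_rate_split_extension R A _ B TA T TB hTA hT hTB
    (@inl_prod A B) fst (@inr_prod A B) snd) => //.
  - by case=> a b; congr pair; rewrite ?mulg1 ?mul1g.
  - exact: left_endo_restr stab.
  - exact: right_endo_quot stab.
rewrite maxC.
apply: (@growth_rate_split_extension R B _ A TB T TA hTB hT hTA
  (@inr_prod A B) snd (@inl_prod A B) fst) => //.
- by case=> a b; congr pair; rewrite ?mulg1 ?mul1g.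
- exact: right_endo_restr stab.
- exact: left_endo_quot stab.
Qed.
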